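(* Let $\mathcal{X}$ be a finite set with $|\mathcal{X}|\geq 2$. Then $(\mathrm{DMC}_{\mathcal{X},\ast}^{(o)},\mathcal{T}_{s,\mathcal{X},\ast}^{(o)})$, where $\mathcal{T}_{s,\mathcal{X},\ast}^{(o)}$ is the strong topology, is not first-countable anywhere, i.e., for every $\hat{W}\in\mathrm{DMC}_{\mathcal{X},\ast}^{(o)}$, there is no countable neighborhood basis of $\hat{W}$.
   Context: For finite nonempty sets $\mathcal{X},\mathcal{Y}$, $\mathrm{DMC}_{\mathcal{X},\mathcal{Y}}$ is the set of channels from $\mathcal{X}$ to $\mathcal{Y}$, i.e. functions $W:\mathcal{X}\times\mathcal{Y}\to[0,1]$, written $W(y|x)$, with $\sum_{y\in\mathcal{Y}}W(y|x)=1$ for every $x\in\mathcal{X}$. It carries the topology $\mathcal{T}_{\mathcal{X},\mathcal{Y}}$ inherited from the Euclidean topology of $\mathbb{R}^{\mathcal{X}\times\mathcal{Y}}$. For $W\in\mathrm{DMC}_{\mathcal{X},\mathcal{Y}}$ and $V\in\mathrm{DMC}_{\mathcal{Y},\mathcal{Z}}$, the composition $V\circ W\in\mathrm{DMC}_{\mathcal{X},\mathcal{Z}}$ is $(V\circ W)(z|x)=\sum_{y\in\mathcal{Y}}V(z|y)W(y|x)$. A channel $W'\in\mathrm{DMC}_{\mathcal{X},\mathcal{Z}}$ is degraded from $W\in\mathrm{DMC}_{\mathcal{X},\mathcal{Y}}$ if $W'=V\circ W$ for some $V\in\mathrm{DMC}_{\mathcal{Y},\mathcal{Z}}$; $W$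 and $W'$ are equivalent if each is degraded from the other. Let $[n]=\{1,\dots,n\}$, let $\mathrm{DMC}_{\mathcal{X},\ast}=\coprod_{n\ge1}\mathrm{DMC}_{\mathcal{X},[n]}$ with the disjoint union topology $\bigoplus_{n\ge1}\mathcal{T}_{\mathcal{X},[n]}$, and let $\mathrm{DMC}_{\mathcal{X},\ast}^{(o)}$ be the quotient of $\mathrm{DMC}_{\mathcal{X},\ast}$ by equivalence of channels. The strong topology $\mathcal{T}_{s,\mathcal{X},\ast}^{(o)}$ is the quotient topology on $\mathrm{DMC}_{\mathcal{X},\ast}^{(o)}$. *)

(* Defs.v *)
From HB Require Import structures.
From mathcomp Require Import all_boot all_order all_algebra generic_quotient.
From mathcomp Require Import all_classical all_reals all_analysis.
Import Order.TTheory GRing.Theory Num.Theory.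
Import numFieldNormedType.Exports.

Set Implicit Arguments.
Unset Strict Implicit.
Unset Printing Implicit Defensive.

Local Open Scope classical_set_scope.
Local Open Scope ring_scope.
Local Open Scope quotient_scope.

(* The ambient space R^(X * Y) carries the product topology, which for a finite
   index set is the Euclidean one. The conditional probability W(y|x) is
   stored at the index (x, y). *)
Definition channels (R : realType) (X Y : finType) :
    set (prod_topology (fun _ : X * Y => R)) :=
  [set W | (forall xy, 0 <= W xy <= 1) /\
           (forall x, \sum_(y : Y) W (x, y) = 1)].

Definition DMC (R : realType) (X Y : finType) : topologicalType :=
  set_type (@channels R X Y).

(* [prob W y x] is W(y|x). *)
Definition prob (R : realType) (X Y : finType) (W : DMC R X Y) (y : Y) (x : X) :
  R := set_val W (x, y).

Lemma prob_ge0 (R : realType) (X Y : finType) (W : DMC R X Y) y x :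
  0 <= prob W y x.
Proof. by have [/(_ (x, y))/andP[]] := set_mem (valP W). Qed.

Lemma prob_sum1 (R : realType) (X Y : finType) (W : DMC R X Y) x :
  \sum_y prob W y x = 1.
Proof. by have [_ /(_ x)] := set_mem (valP W). Qed.

Lemma DMC_eq (R : realType) (X Y : finType) (W W' : DMC R X Y) :
  (forall y x, prob W y x = prob W' y x) -> W = W'.
Proof. by move=> WW'; apply/val_inj/funext => -[x y]; exact: WW'. Qed.

Lemma channelsP (R : realType) (X Y : finType) (f : X * Y -> R) :
  (forall xy, 0 <= f xy) -> (forall x, \sum_y f (x, y) = 1) ->
  f \in @channels R X Y.
Proof.
move=> f0 f1; apply/mem_set; split=> // -[x y]; rewrite f0 /=.
by rewrite -(f1 x) (bigD1 y)//= lerDl sumr_ge0.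
Qed.

Lemma comp_channels (R : realType) (X Y Z : finType)
    (V : DMC R Y Z) (W : DMC R X Y) :
  (fun xz : X * Z => \sum_(y : Y) prob V xz.2 y * prob W y xz.1)
    \in @channels R X Z.
Proof.
apply: channelsP => [xz|x] /=.
  by apply: sumr_ge0 => y _; rewrite mulr_ge0 ?prob_ge0.
rewrite exchange_big /= -[RHS](prob_sum1 W x); apply: eq_bigr => y _.
by rewrite -mulr_suml prob_sum1 mul1r.
Qed.

Definition channel_comp (R : realType) (X Y Z : finType)
    (V : DMC R Y Z) (W : DMC R X Y) : DMC R X Z :=
  exist (fun f => f \in @channels R X Z) _ (comp_channels V W).

Lemma id_channels (R : realType) (X : finType) :
  (fun xy : X * X => (xy.1 == xy.2)%:R : R) \in @channels R X X.
Proof.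
apply: channelsP => [xy|x]; first exact: ler0n.
rewrite (bigD1 x)//= eqxx big1 ?addr0// => y /negbTE.
by rewrite eq_sym => ->.
Qed.

Definition channel_id (R : realType) (X : finType) : DMC R X X :=
  exist (fun f => f \in @channels R X X) _ (id_channels R X).

Lemma prob_comp (R : realType) (X Y Z : finType)
    (V : DMC R Y Z) (W : DMC R X Y) z x :
  prob (channel_comp V W) z x = \sum_y prob V z y * prob W y x.
Proof. by []. Qed.

Lemma prob_id (R : realType) (X : finType) (x' x : X) :
  prob (channel_id R X) x' x = (x == x')%:R.
Proof. by []. Qed.

Lemma channel_comp1 (R : realType) (X Y : finType) (W : DMC R X Y) :
  channel_comp (channel_id R Y) W = W.
Proof.
apply: DMC_eq => y x; rewrite prob_comp (bigD1 y)//= prob_id eqxx mul1r.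
by rewrite big1 ?addr0// => z /negbTE zy; rewrite prob_id zy mul0r.
Qed.

Lemma channel_compA (R : realType) (X Y Z T : finType)
    (U : DMC R Z T) (V : DMC R Y Z) (W : DMC R X Y) :
  channel_comp U (channel_comp V W) = channel_comp (channel_comp U V) W.
Proof.
apply: DMC_eq => t x; rewrite !prob_comp.
under eq_bigr do rewrite prob_comp mulr_sumr.
under [RHS]eq_bigr do rewrite prob_comp mulr_suml.
rewrite exchange_big /=; apply: eq_bigr => y _; apply: eq_bigr => z _.
by rewrite mulrA.
Qed.

Definition degraded (R : realType) (X Y Z : finType)
    (W' : DMC R X Z) (W : DMC R X Y) : Prop :=
  exists V : DMC R Y Z, W' = channel_comp V W.

Definition channel_equiv (R : realType) (X Y Z : finType)
    (W : DMC R X Y) (W' : DMC R X Z) : Prop :=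
  degraded W' W /\ degraded W W'.

Lemma degraded_refl (R : realType) (X Y : finType) (W : DMC R X Y) :
  degraded W W.
Proof. by exists (channel_id R Y); rewrite channel_comp1. Qed.

Lemma degraded_trans (R : realType) (X Y Z T : finType)
    (W : DMC R X Y) (W' : DMC R X Z) (W'' : DMC R X T) :
  degraded W' W -> degraded W'' W' -> degraded W'' W.
Proof.
by move=> [V ->] [V' ->]; exists (channel_comp V' V); rewrite channel_compA.
Qed.

(* The summand of index n is the space of channels with n + 1 outputs, so that
   the output sizes range over the positive integers. *)
Definition DMC_any (R : realType) (X : finType) : topologicalType :=
  {n : nat & DMC R X 'I_n.+1}.

Definition DMC_any_equiv (R : realType) (X : finType) : rel (DMC_any R X) :=
  fun W W' => `[< channel_equiv (projT2 W) (projT2 W') >].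

Lemma DMC_any_equiv_refl (R : realType) (X : finType) :
  reflexive (@DMC_any_equiv R X).
Proof. by move=> W; apply/asboolP; split; exact: degraded_refl. Qed.

Lemma DMC_any_equiv_sym (R : realType) (X : finType) :
  symmetric (@DMC_any_equiv R X).
Proof. by move=> W W'; apply/asboolP/asboolP => -[]. Qed.

Lemma DMC_any_equiv_trans (R : realType) (X : finType) :
  transitive (@DMC_any_equiv R X).
Proof.
move=> W W1 W2 /asboolP[a b] /asboolP[c d]; apply/asboolP; split.
  exact: degraded_trans a c.
exact: degraded_trans d b.
Qed.

Canonical DMC_any_equivRel (R : realType) (X : finType) :=
  EquivRel (@DMC_any_equiv R X) (@DMC_any_equiv_refl R X)
    (@DMC_any_equiv_sym R X) (@DMC_any_equiv_trans R X).

Definition DMCo (R : realType) (X : finType) : topologicalType :=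
  quotient_topology {eq_quot @DMC_any_equivRel R X}.

Definition nbhs_basis (T : topologicalType) (x : T) (B : set (set T)) : Prop :=
  B `<=` nbhs x /\ forall U, nbhs x U -> exists2 V, B V & V `<=` U.

(* Main.v *)
(** Fix two distinct inputs [x0] and [x1]. For all reals [u] and [v] the sum over
    the outputs [y] of [|u W(y|x0) - v W(y|x1)|] decreases under degradation, so
    it is an invariant of the class of [W], and it is continuous on each
    [DMC_{X,[n]}]. As a function of [v] it is convex and piecewise linear, with
    a kink at [u] times each likelihood ratio [W(y|x0) / W(y|x1)]. The product
    of its second differences over [q] disjoint intervals is therefore a
    continuous invariant that vanishes on all channels with fewer than [q]
    outputs. Mixing a channel with a small multiple of one whose likelihood
    ratios fall in all the intervals shows that the invariant is nonzero at
    points of every nonempty open set.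

    Given neighborhoods [B_n] of the class of [W], choose [V_n] in [B_n] at which
    the invariant [g_n] for [q = n + k] is nonzero, where [W] has fewer than [k]
    outputs. The set of all [V] with [g_n(V) <> g_n(V_n)] for every [n] contains
    [W] but none of the [B_n], and it is open because on channels with a bounded
    number of outputs only finitely many of its conditions can fail. *)

Require Import Defs.
From mathcomp Require Import all_boot all_order all_algebra.
From mathcomp Require Import all_classical all_reals all_analysis.
From mathcomp Require Import generic_quotient ring lra.
Import Order.TTheory GRing.Theory Num.Theory.
Import numFieldNormedType.Exports.

Set Implicit Arguments.
Unset Strict Implicit.
Unset Printing Implicit Defensive.

Local Open Scope classical_set_scope.

(** * Second differences of absolute values *)

Section Tent.
Local Open Scope ring_scope.
Variable R : realType.
Implicit Types (q i j : nat) (a b e : R).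

(** Second difference of [v |-> |q a - v b|] on the nodes [2i], [2i+1], [2i+2]. For [b > 0] it lives
    on [2i/q < a/b < (2i+2)/q]; avoiding the quotient lets it vanish when [b = 0]. *)
Definition tent q i a b : R :=
  `|q%:R * a - i.*2%:R * b| + `|q%:R * a - i.*2.+2%:R * b|
  - 2 * `|q%:R * a - i.*2.+1%:R * b|.

Lemma tent_ge0 q i a b : 0 <= tent q i a b.
Proof.
rewrite /tent subr_ge0 -[2]ger0_norm// -normrM.
rewrite (_ : 2 * _ = (q%:R * a - i.*2%:R * b) + (q%:R * a - i.*2.+2%:R * b)).
  exact: ler_normD.
by rewrite -!natr1; ring.
Qed.

Lemma tent_neq0 q i a b : 0 <= b -> tent q i a b != 0 ->
  i.*2%:R * b < q%:R * a < i.*2.+2%:R * b.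
Proof.
rewrite /tent -!natr1; set A := q%:R * a; set c := _%:R => b0.
apply: contra_neqT; rewrite negb_and -!leNgt => /orP[Ac|cA].
  by rewrite !ler0_norm//; nra.
by rewrite !ger0_norm//; nra.
Qed.

Lemma tent_disjoint q i j a b : 0 <= b ->
  tent q i a b != 0 -> tent q j a b != 0 -> i = j.
Proof.
move=> b0 /tent_neq0-/(_ b0)/andP[li ui] /tent_neq0-/(_ b0)/andP[lj uj].
have lt_double m n : m.*2%:R * b < n.*2.+2%:R * b -> (m <= n)%N.
  move=> mn; rewrite leqNgt; apply/negP => nm.
  move: mn; apply/negP; rewrite -leNgt ler_wpM2r// ler_nat.
  by rewrite -doubleS leq_double.
apply/eqP; rewrite eqn_leq; apply/andP.
by split; apply: lt_double; [exact: lt_trans li uj|exact: lt_trans lj ui].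
Qed.

Lemma tent_peak q i e b : 0 < e -> 0 < b -> (0 < q)%N ->
  0 < tent q i (e * (i.*2.+1%:R / q%:R * b)) (e * b).
Proof.
move=> e0 b0 q0; have q0' : q%:R != 0 :> R by rewrite pnatr_eq0 -lt0n.
have eb := mulr_gt0 e0 b0.
have -> : e * (i.*2.+1%:R / q%:R * b) = i.*2.+1%:R * (e * b) / q%:R.
  by ring.
rewrite /tent mulrCA mulfV// mulr1 subrr normr0 mulr0 subr0.
by rewrite -!natr1; apply: ltr_wpDr => //; rewrite normr_gt0; apply/eqP; nra.
Qed.

End Tent.

(** * Invariants of channel equivalence *)

Section Bend.
Local Open Scope ring_scope.
Variables (R : realType) (X : finType) (x0 x1 : X).

Definition absdiff (Y : finType) (W : DMC R X Y) (u v : R) : R :=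
  \sum_y `|u * prob W y x0 - v * prob W y x1|.

(** Triangle inequality at each output [z], then [V] sums to 1 over [z]. *)
Lemma absdiff_degraded (Y Z : finType) (W : DMC R X Y) (W' : DMC R X Z) u v :
  degraded W' W -> absdiff W' u v <= absdiff W u v.
Proof.
move=> [V ->]; rewrite /absdiff.
apply: (@le_trans _ _ (\sum_z \sum_y
    prob V z y * `|u * prob W y x0 - v * prob W y x1|)).
  apply: ler_sum => z _; rewrite !prob_comp !mulr_sumr -sumrB.
  apply: le_trans (ler_norm_sum _ _ _) _; apply: ler_sum => y _.
  rewrite -[in leRHS](ger0_norm (prob_ge0 V z y)) -normrM mulrBr.
  by rewrite [u * _]mulrCA [v * _]mulrCA.
rewrite exchange_big /=; apply: ler_sum => y _.
by rewrite -mulr_suml prob_sum1 mul1r.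
Qed.

Definition bend (Y : finType) q i (W : DMC R X Y) : R :=
  absdiff W q%:R i.*2%:R + absdiff W q%:R i.*2.+2%:R
  - 2 * absdiff W q%:R i.*2.+1%:R.

Lemma bendE (Y : finType) q i (W : DMC R X Y) :
  bend q i W = \sum_y tent q i (prob W y x0) (prob W y x1).
Proof. by rewrite /bend /absdiff mulr_sumr -big_split/= -sumrB. Qed.

Lemma bend_equiv (Y Z : finType) q i (W : DMC R X Y) (W' : DMC R X Z) :
  channel_equiv W W' -> bend q i W = bend q i W'.
Proof.
move=> [W'W WW']; have absE u v : absdiff W u v = absdiff W' u v.
  by apply/le_anti; rewrite !absdiff_degraded.
by rewrite /bend !absE.
Qed.

Definition bends (Y : finType) q (W : DMC R X Y) : R :=
  \prod_(i < q) bend q i W.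

Lemma bends_equiv (Y Z : finType) q (W : DMC R X Y) (W' : DMC R X Z) :
  channel_equiv W W' -> bends q W = bends q W'.
Proof. by move=> WW'; apply: eq_bigr => i _; exact: bend_equiv. Qed.

(* A nonzero factor [bend q i W] has an output in its tent, and the tents are
   disjoint: this is the pigeonhole principle. *)
Lemma bends_eq0 (Y : finType) q (W : DMC R X Y) :
  (#|Y| < q)%N -> bends q W = 0.
Proof.
move=> Yq; apply/eqP; apply: contraTT Yq; rewrite -leqNgt => /prodf_neq0 nz.
have /choice[f fP] (i : 'I_q) :
    exists y, tent q i (prob W y x0) (prob W y x1) != 0.
  apply: contrapT => /forallNP noy; have /negP := nz i isT; apply.
  by rewrite bendE big1// => y _; apply/eqP/negPn/negP/noy.
rewrite -[q]card_ord; apply: (@leq_card _ _ f) => i j fij; apply/val_inj.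
have := fP j; rewrite -fij.
by apply: tent_disjoint (fP i); exact: prob_ge0.
Qed.

End Bend.

(** * Continuity of the invariants *)

Section Continuity.
Local Open Scope ring_scope.
Variables (R : realType) (X Y : finType).

Lemma prob_continuous y x : continuous (fun W : DMC R X Y => prob W y x).
Proof.
move=> W; apply: (@continuous_comp _ _ _ (set_val : DMC R X Y -> _)
    (fun f : prod_topology (fun _ : X * Y => R) => f (x, y))).
  exact: initial_continuous.
exact: (@proj_continuous _ (fun _ : X * Y => R) (x, y)).
Qed.

Lemma DMC_continuous (T : topologicalType) (f : T -> DMC R X Y) :
  (forall y x, continuous (fun t => prob (f t) y x)) -> continuous f.
Proof.
move=> cf; apply: continuous_comp_initial => t.
apply/cvg_sup => -[x y].
exact: (@continuous_comp_initial _ _ _ (fun g : X * Y -> R => g (x, y))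
  (set_val \o f) (cf y x)).
Qed.

Lemma absdiff_continuous (T : topologicalType) (f : T -> DMC R X Y) x0 x1 u v :
  continuous f -> continuous (fun t => absdiff x0 x1 (f t) u v).
Proof.
move=> cf; apply: (@continuous_big _ _ _ _ _ add_continuous) => y _ t.
have cp x : prob (f s) y x @[s --> t] --> prob (f t) y x.
  exact: (continuous_comp (cf t) (@prob_continuous y x (f t))).
by apply: cvg_norm; apply: cvgB; apply: cvgMl_tmp; exact: cp.
Qed.

Lemma bends_continuous (T : topologicalType) (f : T -> DMC R X Y) x0 x1 q :
  continuous f -> continuous (fun t => bends x0 x1 q (f t)).
Proof.
move=> cf; apply: (@continuous_big _ _ _ _ _ mul_continuous) => i _ t.
apply: cvgB; first by apply: cvgD; exact: absdiff_continuous.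
by apply: cvgMl_tmp; exact: absdiff_continuous.
Qed.

End Continuity.

(** * Perturbing a channel within a larger output alphabet *)

Section Perturbation.
Local Open Scope ring_scope.
Variables (R : realType) (X : finType).

(** Clamping makes the mixture a channel for every real [e], so it is a continuous path around 0. *)
Definition weight (e : R) : R := Num.min 1 `|e|.

Lemma weight_itv e : 0 <= weight e <= 1.
Proof. by rewrite le_min ler01 normr_ge0 ge_min lexx. Qed.

Lemma weight0 : weight 0 = 0.
Proof. by rewrite /weight normr0 min_r. Qed.

Lemma weight_gt0 e : 0 < e -> 0 < weight e.
Proof. by move=> e0; rewrite lt_min ltr01 normr_gt0 gt_eqF. Qed.

Lemma weight_continuous : continuous weight.
Proof.
move=> e; apply: continuous_min; first exact: cvg_cst.
exact: norm_continuous.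
Qed.

Lemma mix_channels (Y : finType) (V W : DMC R X Y) (e : R) :
  (fun xy : X * Y => (1 - weight e) * prob V xy.2 xy.1
    + weight e * prob W xy.2 xy.1) \in @channels R X Y.
Proof.
have /andP[e0 e1] := weight_itv e; apply: channelsP => [xy|x] /=.
  by rewrite addr_ge0// mulr_ge0 ?prob_ge0 ?subr_ge0.
by rewrite big_split -!mulr_sumr/= !prob_sum1 !mulr1 subrK.
Qed.

Definition channel_mix (Y : finType) (V W : DMC R X Y) (e : R) : DMC R X Y :=
  exist (fun f => f \in @channels R X Y) _ (mix_channels V W e).

Lemma prob_mix (Y : finType) (V W : DMC R X Y) e y x :
  prob (channel_mix V W e) y x
  = (1 - weight e) * prob V y x + weight e * prob W y x.
Proof. by []. Qed.

Lemma channel_mix0 (Y : finType) (V W : DMC R X Y) : channel_mix V W 0 = V.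
Proof.
by apply: DMC_eq => y x; rewrite prob_mix weight0 subr0 mul1r mul0r addr0.
Qed.

Lemma channel_mix_continuous (Y : finType) (V W : DMC R X Y) :
  continuous (channel_mix V W).
Proof.
apply: DMC_continuous => y x e; under eq_fun do rewrite prob_mix.
apply: cvgD; apply: cvgMr_tmp; last exact: weight_continuous.
by apply: cvgB; [exact: cvg_cst|exact: weight_continuous].
Qed.

Lemma map_channels (Y Z : finType) (f : Y -> Z) :
  (fun yz : Y * Z => (f yz.1 == yz.2)%:R : R) \in @channels R Y Z.
Proof.
apply: channelsP => [yz|y]; first exact: ler0n.
rewrite (bigD1 (f y))//= eqxx big1 ?addr0// => z /negbTE.
by rewrite eq_sym => ->.
Qed.

Definition channel_map (Y Z : finType) (f : Y -> Z) : DMC R Y Z :=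
  exist (fun g => g \in @channels R Y Z) _ (map_channels f).

Lemma prob_map (Y Z : finType) (f : Y -> Z) (W : DMC R X Y) z x :
  prob (channel_comp (channel_map f) W) z x = \sum_(y | f y == z) prob W y x.
Proof.
rewrite prob_comp [RHS]big_mkcond; apply: eq_bigr => y _.
rewrite -[prob (channel_map f) z y]/((f y == z)%:R).
by case: eqP => _; rewrite ?mul1r ?mul0r.
Qed.

Lemma channel_map_equiv (Y Z : finType) (f : Y -> Z) (g : Z -> Y)
    (W : DMC R X Y) :
  cancel f g -> channel_equiv (channel_comp (channel_map f) W) W.
Proof.
move=> fK; split; last by exists (channel_map f).
exists (channel_map g); apply: DMC_eq => y x.
rewrite prob_map; under eq_bigr do rewrite prob_map.
rewrite (exchange_big_dep predT)//= (bigD1 y)//= [X in _ + X]big1 ?addr0.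
  rewrite (bigD1 (f y)) /= ?fK ?eqxx// big1 ?addr0//.
  by move=> z /andP[/andP[_ /eqP->]]/eqP.
move=> y' y'y; rewrite big1// => z /andP[/eqP gz /eqP fz].
by move: y'y; rewrite -gz -fz fK eqxx.
Qed.

Lemma sum_odd q : \sum_(i < q) i.*2.+1%:R = q%:R ^+ 2 :> R.
Proof.
elim: q => [|q IH]; first by rewrite big_ord0 expr0n.
by rewrite big_ord_recr IH/= -!natr1 -muln2 natrM; ring.
Qed.

(* The likelihood ratios [(2 i + 1) / (q + 1)] of the outputs are the peaks of the
   tents. *)
Lemma peak_channels (x0 : X) q :
  (fun xi : X * 'I_q.+1 => (if xi.1 == x0 then xi.2.*2.+1%:R / q.+1%:R else 1)
     * q.+1%:R^-1 : R) \in @channels R X 'I_q.+1.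
Proof.
have q0 : q.+1%:R != 0 :> R by rewrite pnatr_eq0.
apply: channelsP => [xi|x] /=.
  by rewrite mulr_ge0//; case: ifP => // _; rewrite divr_ge0.
rewrite -mulr_suml; case: eqP => _.
  by rewrite -mulr_suml sum_odd expr2 mulfK// divff.
by rewrite sumr_const card_ord divff.
Qed.

Definition peak_channel (x0 : X) q : DMC R X 'I_q.+1 :=
  exist (fun f => f \in @channels R X 'I_q.+1) _ (peak_channels x0 q).

Lemma prob_peak x0 q (i : 'I_q.+1) x :
  prob (peak_channel x0 q) i x
  = (if x == x0 then i.*2.+1%:R / q.+1%:R else 1) * q.+1%:R^-1.
Proof. by []. Qed.

(** Separate output blocks keep the likelihood ratios of the peak channel intact under mixing. *)
Definition perturb (x0 : X) (n q : nat) (W : DMC R X 'I_n) (e : R) :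
    DMC R X 'I_(n + q.+1) :=
  channel_mix (channel_comp (channel_map (@lshift n q.+1)) W)
    (channel_comp (channel_map (@rshift n q.+1)) (peak_channel x0 q)) e.

Lemma prob_perturb x0 n q (W : DMC R X 'I_n) e i x :
  prob (perturb x0 q W e) (rshift n i) x
  = weight e * prob (peak_channel x0 q) i x.
Proof.
rewrite prob_mix !prob_map big_pred0 ?mulr0 ?add0r => [|j]; last first.
  by rewrite eq_lrshift.
by under eq_bigl do rewrite eq_rshift; rewrite big_pred1_eq.
Qed.

Lemma bends_perturb x0 x1 n q (W : DMC R X 'I_n) e : x0 != x1 -> 0 < e ->
  bends x0 x1 q.+1 (perturb x0 q W e) != 0.
Proof.
move=> x01 e0; apply/prodf_neq0 => i _; rewrite bendE gt_eqF//.
(* One output at the peak of tent [i] suffices, since no tent is negative. *)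
rewrite (bigD1 (rshift n i))//= ltr_pwDl//; last first.
  by apply: sumr_ge0 => y _; exact: tent_ge0.
rewrite !prob_perturb !prob_peak eqxx eq_sym (negbTE x01) mul1r.
by apply: tent_peak => //; exact: weight_gt0.
Qed.

Lemma perturb_continuous x0 n q (W : DMC R X 'I_n) :
  continuous (perturb x0 q W).
Proof. exact: channel_mix_continuous. Qed.

Lemma perturb0_equiv x0 n q (W : DMC R X 'I_n.+1) :
  channel_equiv (perturb x0 q W 0) W.
Proof.
rewrite /perturb channel_mix0.
(* Only a left inverse of [lshift] is needed, so the value [ord0] is arbitrary. *)
pose g (y : 'I_(n.+1 + q.+1)) := if fintype.split y is inl i then i else ord0.
apply: (@channel_map_equiv _ _ _ g) => i.
by rewrite /g -[lshift _ _]/(unsplit (inl i)) unsplitK.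
Qed.

End Perturbation.

(** * Passage to the quotient *)

Section QuotientBends.
Local Open Scope ring_scope.
Variables (R : realType) (X : finType) (x0 x1 : X).

Definition bendso q (V : DMCo R X) : R := bends x0 x1 q (projT2 (repr V)).

Lemma bendso_pi q (W : DMC_any R X) :
  bendso q (\pi_(DMCo R X)%qT W) = bends x0 x1 q (projT2 W).
Proof.
apply: bends_equiv; apply/asboolP.
by have /eqmodP := reprK (\pi_(DMCo R X)%qT W).
Qed.

Lemma nbhs_bendso_neq0 q (V : DMCo R X) U : x0 != x1 -> nbhs V U ->
  exists2 V', U V' & bendso q.+1 V' != 0.
Proof.
rewrite -[V]reprK; case: (repr V) => n W.
move=> x01; rewrite nbhsE => -[A [oA AW] AU].
pose f e : DMC_any R X :=
  existT (fun n => DMC R X 'I_n.+1) (n + q.+1)%N (perturb x0 q W e).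
have cf : continuous f.
  move=> e; apply: continuous_comp; first exact: perturb_continuous.
  exact: existT_continuous.
have Af0 : A (\pi_(DMCo R X)%qT (f 0)).
  suff -> : \pi_(DMCo R X)%qT (f 0) =
            \pi_(DMCo R X)%qT (existT (fun n => DMC R X 'I_n.+1) n W) by [].
  by apply/eqmodP/asboolP; exact: perturb0_equiv.
have : nbhs (0 : R) (f @^-1` (\pi_(DMCo R X)%qT @^-1` A)).
  apply: open_nbhs_nbhs; split => //; apply: open_comp => [e _|].
    exact: cf.
  exact: oA.
move=> /nbhs_ballP[e /= e0 /(_ (e / 2)) Ae].
exists (\pi_(DMCo R X)%qT (f (e / 2))).
  apply: AU; apply: Ae.
  rewrite /ball/= sub0r normrN gtr0_norm ?divr_gt0//.
  by rewrite ltr_pdivrMr// ltr_pMr// ltr1n.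
rewrite bendso_pi; apply: (@bends_perturb _ _ _ _ n.+1) => //.
by rewrite divr_gt0.
Qed.

(* A channel with [m.+1] outputs only meets the finitely many conditions
   with [n + k <= m.+1], the other ones hold because [bends] is then 0. *)
Lemma open_bendso_neq k (c : nat -> R) : (forall n, c n != 0) ->
  open [set V : DMCo R X | forall n, bendso (n + k) V != c n].
Proof.
move=> c0; rewrite /open/= /quotient_open; apply/sigT_openP => m.
rewrite (_ : _ @^-1` _ = ~` \bigcup_(n in `I_m.+2)
    [set W : DMC R X 'I_m.+1 | bends x0 x1 (n + k) W = c n]).
  rewrite openC; apply: closed_bigcup; first exact: finite_II.
  move=> n _; apply: (@closed_comp _ _ (bends x0 x1 (n + k))
    [set a : R | a = c n]).
    by move=> W _; apply: (@bends_continuous _ _ _ _ id) => ?; exact: cvg_id.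
  exact: closed_eq.
apply/seteqP; split => W /= HW.
  by move=> [n _ /= Wn]; have := HW n; rewrite bendso_pi Wn eqxx.
move=> n; rewrite bendso_pi /=; have [nm|mn] := ltnP n m.+2.
  by apply/eqP => Wn; apply: HW; exists n.
by rewrite bends_eq0 1?eq_sym// card_ord (leq_trans mn)// leq_addr.
Qed.

End QuotientBends.

(** * The diagonal argument *)

Theorem corollary9 (R : realType) (X : finType) (hX : (2 <= #|X|)%N)
    (W : DMCo R X) :
  ~ (exists B : set (set (DMCo R X)), countable B /\ nbhs_basis W B).
Proof.
move=> [B [cB [BW basisB]]].
have /card_gt1P[x0 [x1 [_ _ x01]]] := hX.
(* [B] is empty, which the neighborhood [setT] excludes, or it is enumerated by [f]. *)
have [B0|[f]] := pfcard_geP cB.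
  by have [V] := basisB _ filterT; rewrite B0.
have Bf n : B (f n) by exact: funS.
(* The representative has [(projT1 (repr W)).+1] outputs, one fewer than [k], so all its invariants
   from [k] on vanish. *)
pose k := (projT1 (repr W)).+2.
have /choice[V VP] n :
    exists V, f n V /\ bendso x0 x1 (n + k) V != 0%R.
  have [V fV V0] := nbhs_bendso_neq0 (n + k.-1) x01 (BW _ (Bf n)).
  by exists V; split => //; rewrite addnS.
pose U := [set V' : DMCo R X | forall n,
  bendso x0 x1 (n + k) V' != bendso x0 x1 (n + k) (V n)].
have [A BA AU] : exists2 A, B A & A `<=` U.
  apply: basisB; apply: open_nbhs_nbhs; split.
    by apply: open_bendso_neq => n; have [] := VP n.
  move=> n; rewrite {1}/bendso bends_eq0 1?eq_sym; first by have [] := VP n.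
  by rewrite card_ord leq_addl.
(* If [A] is [f n], then [V n] lies in [U] and violates its own condition [n]. *)
have [n _ fnA] := @surj _ _ _ _ f _ BA.
by have [+ _] := VP n; rewrite fnA => /AU/(_ n); rewrite eqxx.
Qed.
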